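(* Let $n\ge3$. Consider $\mathcal{K}_3$ and $\mathcal{W}_n$ either both as plain semigroups, or both as involution semigroups with respect to the reflection ${}^*$. Then every variety $\mathbf{V}$ of semigroups (respectively, of involution semigroups) such that $\operatorname{var}\mathcal{K}_3\subseteq\mathbf{V}\subseteq\operatorname{var}\mathcal{W}_n$ is nonfinitely based.
   Context: For $n\ge2$, let $[n]=\{1,\dots,n\}$ and $[n]'=\{1',\dots,n'\}$. The wire monoid $\mathcal{W}_n$ has as elements all pairs $(\pi;d)$ where $\pi$ is a partition of $[n]\cup[n]'$ into 2-element blocks and $d\ge0$ is an integer. The product of $\xi=(\pi_1;d_1)$ and $\eta=(\pi_2;d_2)$ is defined as follows. Take a third disjoint copy $[n]''=\{1'',\dots,n''\}$ and form the multigraph $\Gamma$ on $[n]\cup[n]''\cup[n]'$ whose edges are: $\{\sigma(x),\sigma(y)\}$ for each block $\{x,y\}$ of $\pi_1$, where $\sigma$ fixes $[n]$ and sends $k'\mapsto k''$; and $\{\tau(x),\tau(y)\}$ for each block $\{x,y\}$ of $\pi_2$, where $\tau$ sends $k\mapsto k''$ and fixes $[n]'$. Its components are paths between two vertices of $[n]\cup[n]'$ and cycles inside $[n]''$. Then $\xi\eta=(\pi;d_1+d_2+m)$, where the blocks of $\pi$ are the endpoint pairs of the paths and $m$ is the number of cycles. The identity is $(\{\{k,k'\}\};0)$. The reflection is $(\pi;d)^*=(\pi^*;d)$, obtained by swapping $k\leftrightarrow k'$ in every block; it is an involution. The hooks are $h_i=(\{\{i,i+1\},\{i',(i+1)'\}\}\cup\{\{j,j'\}\mid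 j\ne i,i+1\};0)$ and the circle is $c=(\{\{j,j'\}\mid j\in[n]\};1)$. The Kauffman monoid $\mathcal{K}_n$ is the submonoid of $\mathcal{W}_n$ generated by $c,h_1,\dots,h_{n-1}$. Equivalently, it is the monoid presented by $h_ih_j=h_jh_i$ for $|i-j|\ge2$, $h_ih_jh_i=h_i$ for $|i-j|=1$, and $h_i^2=ch_i=h_ic$. It is closed under ${}^*$, which fixes each generator. $\operatorname{var}\mathcal{S}$ denotes the variety of semigroups (resp. involution semigroups) generated by $\mathcal{S}$. A variety is nonfinitely based if it has no finite basis of identities. *)

(* Defs.v *)
From mathcomp Require Import all_boot.
Set Implicit Arguments. Unset Strict Implicit. Unset Printing Implicit Defensive.

(* Points of [n] ∪ [n]' : inl k = (k+1), inr k = (k+1)'  (0-indexed). *)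
Definition pts (n : nat) := ('I_n + 'I_n)%type.

(* An element (pi; d): pi is encoded by its "partner" function
   (x |-> the other element of the block of x), d the number of circles.
   Valid elements are those whose partner function is a fixed-point-free
   involution, i.e. exactly the partitions into 2-element blocks. *)
Definition Welt (n : nat) := ({ffun pts n -> pts n} * nat)%type.

Definition wvalid n (w : Welt n) : Prop :=
  forall x : pts n, w.1 (w.1 x) = x /\ w.1 x != x.

Definition swp n (x : pts n) : pts n :=
  match x with inl k => inr k | inr k => inl k end.

(* Vertices of Gamma: [n] ∪ [n]' (inl) and the middle copy [n]'' (inr). *)
Definition vtx (n : nat) := (pts n + 'I_n)%type.

Definition sig_ n (x : pts n) : vtx n :=
  match x with inl k => inl (inl k) | inr k => inr k end.
Definition tau_ n (x : pts n) : vtx n :=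
  match x with inl k => inr k | inr k => inl (inr k) end.

Definition gedge n (p1 p2 : {ffun pts n -> pts n}) : rel (vtx n) :=
  fun u v => [exists x : pts n,
    [|| (sig_ x == u) && (sig_ (p1 x) == v), (sig_ x == v) && (sig_ (p1 x) == u),
        (tau_ x == u) && (tau_ (p2 x) == v) | (tau_ x == v) && (tau_ (p2 x) == u)]].

Definition is_mid n (v : vtx n) : bool := if v is inr _ then true else false.

(* product: blocks = endpoint pairs of paths, m = number of components
   lying entirely inside [n]'' (the cycles) *)
Definition wmul n (xi eta : Welt n) : Welt n :=
  let e := gedge xi.1 eta.1 in
  ([ffun a : pts n =>
      odflt a [pick b : pts n | (b != a) && connect e (inl a) (inl b)]],
   xi.2 + eta.2 +
   #|[set [set y | connect e x y] | x : vtx n & [forall y, connect e x y ==> is_mid y]]|).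

Definition wstar n (w : Welt n) : Welt n := ([ffun x => swp (w.1 (swp x))], w.2).

Definition wid n : Welt n := ([ffun x => swp x], 0).
Definition circ n : Welt n := ([ffun x => swp x], 1).

(* hook h_{i+1} (0-indexed i, requires i.+1 < n):
   blocks {i+1, i+2}, {(i+1)', (i+2)'}, and {j, j'} for the other j *)
Definition hrel n (i : nat) (x y : pts n) : bool :=
  match x, y with
  | inl a, inl b | inr a, inr b =>
      ((a == i :> nat) && (b == i.+1 :> nat)) || ((a == i.+1 :> nat) && (b == i :> nat))
  | inl a, inr b | inr a, inl b =>
      (a == b) && (a != i :> nat) && (a != i.+1 :> nat)
  end.
Definition hook n (i : nat) : Welt n :=
  ([ffun x => odflt x [pick y : pts n | hrel i x y]], 0).

Inductive inK (n : nat) : Welt n -> Prop :=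
  | inK_one : inK (wid n)
  | inK_c : inK (circ n)
  | inK_h i : i.+1 < n -> inK (hook n i)
  | inK_mul x y : inK x -> inK y -> inK (wmul x y).

(* words over the variables x_0, x_1, ... : nonempty sequences *)
Definition word := (nat * seq nat)%type.
Definition ev (S : Type) (mul : S -> S -> S) (f : nat -> S) (w : word) : S :=
  foldl (fun a i => mul a (f i)) (f w.1) w.2.

Definition sat (S : Type) (mul : S -> S -> S) (P : S -> Prop) (s : word * word) : Prop :=
  forall f : nat -> S, (forall i, P (f i)) -> ev mul f s.1 = ev mul f s.2.

Definition is_sg (S : Type) (mul : S -> S -> S) : Prop :=
  forall x y z, mul x (mul y z) = mul (mul x y) z.

Definition sat_all (S : Type) (mul : S -> S -> S) (Sig : word * word -> Prop) : Prop :=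
  forall s, Sig s -> sat mul (fun _ => True) s.

Definition sg_finitely_based (Sig : word * word -> Prop) : Prop :=
  exists L : seq (word * word), forall (S : Type) (mul : S -> S -> S), is_sg mul ->
    (sat_all mul Sig <-> sat_all mul (fun s => s \in L)).

(* letters: (i, false) = x_i, (i, true) = x_i^* *)
Definition iword := ((nat * bool) * seq (nat * bool))%type.
Definition iev (S : Type) (mul : S -> S -> S) (star : S -> S) (f : nat -> S)
    (w : iword) : S :=
  let lt (l : nat * bool) := if l.2 then star (f l.1) else f l.1 in
  foldl (fun a l => mul a (lt l)) (lt w.1) w.2.

Definition isat (S : Type) (mul : S -> S -> S) (star : S -> S) (P : S -> Prop)
    (s : iword * iword) : Prop :=
  forall f : nat -> S, (forall i, P (f i)) -> iev mul star f s.1 = iev mul star f s.2.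

Definition is_isg (S : Type) (mul : S -> S -> S) (star : S -> S) : Prop :=
  is_sg mul /\ (forall x y, star (mul x y) = mul (star y) (star x)) /\
  (forall x, star (star x) = x).

Definition isat_all (S : Type) (mul : S -> S -> S) (star : S -> S)
    (Sig : iword * iword -> Prop) : Prop :=
  forall s, Sig s -> isat mul star (fun _ => True) s.

Definition isg_finitely_based (Sig : iword * iword -> Prop) : Prop :=
  exists L : seq (iword * iword),
    forall (S : Type) (mul : S -> S -> S) (star : S -> S), is_isg mul star ->
    (isat_all mul star Sig <-> isat_all mul star (fun s => s \in L)).

(* Main.v *)
Require Import Defs.
From mathcomp Require Import all_boot zify.
Set Implicit Arguments. Unset Strict Implicit. Unset Printing Implicit Defensive.

(** The middle part of a product of wires takes finitely many values, while the
    circle counts simply add up.  Hence if, for every substitution, three prefixes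
    [r], [rp], [rpq] of a word have the same wire part, then [rpq = rqp] holds in
    [W_n]; by pigeonhole every long enough word over a fixed alphabet starts with
    such an [rpq].

    Given [m], take a square-free word that is a fixed point of a uniform morphism
    [gamma] of length [r = m + 3], the [t]-th letter of each block carrying the type
    [t].  Let [S] be the semigroup of factors of a long prefix of this word and of
    its formal reversal, with a zero.  By square-freeness [rpq = rqp] fails in [S].
    On the other hand [S] satisfies every identity [u = v] of [K_3] with [u] of
    length at most [m]: identities of [K_3] preserve, after deleting any set of
    letters, the first letter, the last letter and the set of adjacent pairs; if
    [phi(u)] is a factor, some type [i > 0] is not the type of the first letter of
    any [phi(x)], so collecting the [gamma]-preimages of the blocks whose type [i]
    letter occurs in [phi(x)] gives a substitution sending [u] to a shorter factor,
    and induction together with the preserved data yields [phi(v) = phi(u)].  So no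
    finite set of identities suffices. *)

(** * A model of the Kauffman monoid of degree 3 *)

(* [(d, None)] stands for [c^d] and [(d, Some (i, j))] for [c^d e_ij], where [e_ij]
   has its upper hook at position [i] and its lower hook at position [j];
   thus [e_ij e_kl = c^[j = k] e_il]. *)
Definition kel := (nat * option (bool * bool))%type.

Definition kmul (a b : kel) : kel :=
  match a.2, b.2 with
  | None, o => (a.1 + b.1, o)
  | o, None => (a.1 + b.1, o)
  | Some (i, j), Some (k, l) => (a.1 + b.1 + (j == k), Some (i, l))
  end.

Definition kstar (a : kel) : kel := (a.1, omap (fun p => (p.2, p.1)) a.2).

Definition kone : kel := (0, None).

Lemma kmulA : is_sg kmul.
Proof.
by move=> [d [[i j]|]] [e [[k l]|]] [f [[p q]|]]; rewrite /kmul //=; congr (_, _); lia.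
Qed.

Lemma kmul1 a : kmul kone a = a.
Proof. by case: a => [d [[i j]|]]. Qed.

Lemma kmulr1 a : kmul a kone = a.
Proof. by case: a => [d [[i j]|]]; rewrite /kmul /= addn0. Qed.

Lemma kstarK : involutive kstar.
Proof. by case=> [d [[i j]|]]. Qed.

Lemma kstarM x y : kstar (kmul x y) = kmul (kstar y) (kstar x).
Proof.
case: x y => [d [[i j]|]] [e [[k l]|]]; rewrite /kmul /kstar //=; congr (_, _);
  by rewrite 1?eq_sym; lia.
Qed.

Definition o0 : 'I_3 := @Ordinal 3 0 isT.
Definition o1 : 'I_3 := @Ordinal 3 1 isT.
Definition o2 : 'I_3 := @Ordinal 3 2 isT.
Definition ords3 : seq 'I_3 := [:: o0; o1; o2].
Definition pts3 : seq (pts 3) := [seq inl k | k <- ords3] ++ [seq inr k | k <- ords3].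
Definition vtx3 : seq (vtx 3) := [seq inl k | k <- pts3] ++ [seq inr k | k <- ords3].

Lemma mem_ords3 k : k \in ords3.
Proof. by case: k => [[|[|[|k]]] hk]. Qed.

Lemma mem_pts3 x : x \in pts3.
Proof.
by rewrite mem_cat; case: x => k; rewrite map_f ?mem_ords3 ?orbT.
Qed.

Lemma mem_vtx3 x : x \in vtx3.
Proof.
by rewrite mem_cat; case: x => k; rewrite map_f ?mem_pts3 ?mem_ords3 ?orbT.
Qed.

Definition cup (i : bool) (k : 'I_3) : option 'I_3 :=
  match i, nat_of_ord k with
  | false, 0 => Some o1
  | false, 1 => Some o0
  | true, 1 => Some o2
  | true, 2 => Some o1
  | _, _ => None
  end.

Definition thru (j : bool) : 'I_3 := if j then o0 else o2.

Definition jones (o : option (bool * bool)) (x : pts 3) : pts 3 :=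
  if o is Some (i, j) then
    match x with
    | inl k => if cup i k is Some l then inl l else inr (thru j)
    | inr k => if cup j k is Some l then inr l else inl (thru i)
    end
  else swp x.

Definition ktheta (a : kel) : Welt 3 := (finfun (jones a.2), a.1).

(** * Products of diagrams of degree 3 by computation *)

Section Product3.
Variables p1 p2 q : pts 3 -> pts 3.

Definition nbrs (u : vtx 3) : seq (vtx 3) :=
  match u with
  | inl (inl k) => [:: sig_ (p1 (inl k))]
  | inl (inr k) => [:: tau_ (p2 (inr k))]
  | inr k => [:: sig_ (p1 (inr k)); tau_ (p2 (inl k))]
  end.

Definition reach k u : seq (vtx 3) :=
  iter k (fun s => undup (flatten [seq v :: nbrs v | v <- s])) [:: u].

(* Eight rounds suffice since the graph has nine vertices. *)
Definition repr (u : vtx 3) : vtx 3 :=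
  let s := reach 8 u in nth u vtx3 (find (fun v => v \in s) vtx3).

Definition midclass : seq (vtx 3) :=
  [seq x <- vtx3 | all (fun y => (repr x == repr y) ==> is_mid y) vtx3].

Definition product_check (m : bool) : bool :=
  [&& all (fun x => (repr (sig_ x) == repr (sig_ (p1 x)))
                 && (repr (tau_ x) == repr (tau_ (p2 x)))) pts3,
      all (fun u => repr u \in reach 8 u) vtx3,
      all (fun a => [&& q a != a, repr (inl a) == repr (inl (q a)) &
        all (fun b => (b != a) && (repr (inl a) == repr (inl b)) ==> (b == q a)) pts3]) pts3,
      m == (midclass != [::]) & constant (map repr midclass)].

Local Notation e := (gedge (finfun p1) (finfun p2)).

Lemma nbrs_edge u v : v \in nbrs u -> e u v.
Proof.
move=> h; apply/existsP; case: u h => [[k|k]|k] /=; rewrite !inE.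
- by move=> /eqP->; exists (inl k); rewrite !ffunE /= !eqxx.
- by move=> /eqP->; exists (inr k); rewrite !ffunE /= !eqxx !orbT.
- case/orP=> /eqP->; first by exists (inr k); rewrite !ffunE /= !eqxx.
  by exists (inl k); rewrite !ffunE /= !eqxx !orbT.
Qed.

Lemma reach_connect k u v : v \in reach k u -> connect e u v.
Proof.
elim: k v => [|k IH] v; first by rewrite inE => /eqP->.
rewrite /reach iterS mem_undup => /flattenP[s /mapP[x hx ->]].
rewrite inE => /orP[/eqP->|hv]; first exact: IH.
exact: connect_trans (IH _ hx) (connect1 (nbrs_edge hv)).
Qed.

Lemma gedge_sym : symmetric e.
Proof.
by move=> u v; apply/existsP/existsP=> -[x hx]; exists x;
  case/or4P: hx => ->; rewrite ?orbT.
Qed.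

(** The check makes [repr u] reachable from [u] and [repr] constant along edges, so [repr] labels
    components exactly. It also allows at most one component in the middle, which is why the cycle
    count is a boolean. *)
Lemma wmul_check m d d' : product_check m ->
  wmul (finfun p1, d) (finfun p2, d') = (finfun q, d + d' + m).
Proof.
case/and5P=> /allP hedge /allP hreach /allP hq /eqP hm hconst.
have repr_edge u v : e u v -> repr u = repr v.
  case/existsP=> x; have /andP[/eqP h1 /eqP h2] := hedge x (mem_pts3 x).
  by rewrite !ffunE => /or4P[] /andP[/eqP<- /eqP<-].
have connectE u v : connect e u v = (repr u == repr v).
  apply/idP/eqP=> [|huv].
    case/connectP=> p; elim: p u => [|x p IH] u /=; first by move=> _ ->.
    by case/andP=> /repr_edge -> hp hv; apply: IH.
  apply: connect_trans (reach_connect (hreach u (mem_vtx3 u))) _.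
  rewrite huv (sym_connect_sym gedge_sym).
  exact: reach_connect (hreach v (mem_vtx3 v)).
rewrite /wmul /=; congr (_, _ + _).
  apply/ffunP=> a; rewrite !ffunE.
  have /and3P[h1 h2 /allP h3] := hq a (mem_pts3 a).
  case: pickP => [b|/(_ (q a))] /=.
    by rewrite connectE => h; have /implyP/(_ h)/eqP := h3 b (mem_pts3 b).
  by rewrite connectE h1 h2.
have midE x : [forall y, connect e x y ==> is_mid y] = (x \in midclass).
  rewrite mem_filter mem_vtx3 andbT; apply/forallP/allP=> h y.
    by move=> _; have := h y; rewrite connectE.
  by rewrite connectE; apply: h; apply: mem_vtx3.
case: midclass midE hm hconst => [|x0 s] midE -> hconst.
  apply: eq_card0 => A; apply/imsetP=> -[x].
  by rewrite inE midE in_nil.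
rewrite -[RHS](cards1 [set y | connect e x0 y]); apply: eq_card => A.
rewrite in_set1; apply/imsetP/eqP=> [[x hx ->]|->]; last first.
  by exists x0 => //; rewrite inE midE mem_head.
move: hx; rewrite inE midE => hx.
apply/setP=> y; rewrite !inE !connectE.
suff -> : repr x = repr x0 by [].
move: hx hconst; rewrite inE /= => /orP[/eqP->//|hx] /allP/(_ (repr x)).
by rewrite map_f // => /(_ isT)/eqP.
Qed.

End Product3.

(** Circles of the factors simply add up, which leaves 25 pairs of diagrams to compute. *)
Lemma ktheta_mul a b : ktheta (kmul a b) = wmul (ktheta a) (ktheta b).
Proof.
pose o := (kmul (0, a.2) (0, b.2)).2; pose m := (kmul (0, a.2) (0, b.2)).1 == 1.
have hm : kmul a b = (a.1 + b.1 + m, o).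
  rewrite /kmul /o /m; clear o m; case: a b => [d [[[] []]|]] [e [[[] []]|]]; by rewrite /= ?addn0.
rewrite hm /ktheta; symmetry; apply: wmul_check; rewrite /m /o.
clear hm m o; case: a b => [_ a] [_ b] /=.
by case: a => [[[] []]|]; case: b => [[[] []]|]; vm_compute.
Qed.

Lemma ktheta_star a : ktheta (kstar a) = wstar (ktheta a).
Proof.
case: a => d o; congr (_, _); apply/ffunP=> x; rewrite !ffunE /=.
by case: o => [[i j]|]; case: x => k //=; case: (cup _ k).
Qed.

Lemma ktheta_inj : injective ktheta.
Proof.
move=> [d o] [e o'] [/ffunP h ->]; congr (_, _).
have /= := h (inl o0); have /= := h (inl o1); have /= := h (inr o0); have /= := h (inr o1).
rewrite !ffunE.
by case: o {h} => [[[] []]|]; case: o' => [[[] []]|].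
Qed.

Lemma hook3E (i : bool) : hook 3 i = ktheta (0, Some (i, i)).
Proof.
congr (_, _); apply/ffunP=> x; rewrite !ffunE.
case: pickP => [y|/(_ (jones (Some (i, i)) x))] /=.
  by case: i x y => [] [[[|[|[|x]]] hx]|[[|[|[|x]]] hx]] [[[|[|[|y]]] hy]|[[|[|[|y]]] hy]] //= _;
  congr (_ _); apply: val_inj.
by case: i x => [] [[[|[|[|x]]] hx]|[[|[|[|x]]] hx]].
Qed.

Lemma ktheta_inK a : inK (ktheta a).
Proof.
have hc : circ 3 = ktheta (1, None) by [].
case: a => [d o]; elim: d => [|d IH]; last first.
  by rewrite (_ : ktheta _ = wmul (circ 3) (ktheta (d, o))); [apply: inK_mul => //; apply: inK_c|
    rewrite hc -ktheta_mul; case: o {IH}].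
have hh (i : bool) : inK (ktheta (0, Some (i, i))).
  by rewrite -hook3E; apply: inK_h; case: i.
case: o => [[i j]|]; last exact: inK_one.
case: (boolP (i == j)) => [/eqP<- //|hij].
(* For [i != j] the two hooks multiply to e_ij without closing a circle. *)
rewrite (_ : ktheta _ = wmul (ktheta (0, Some (i, i))) (ktheta (0, Some (j, j)))).
  exact: inK_mul.
by rewrite -ktheta_mul /kmul /= (negbTE hij).
Qed.

Lemma ktheta_iev f w :
  ktheta (iev kmul kstar f w) = iev (@wmul 3) (@wstar 3) (fun i => ktheta (f i)) w.
Proof.
have hl (l : nat * bool) : ktheta (if l.2 then kstar (f l.1) else f l.1) =
    if l.2 then wstar (ktheta (f l.1)) else ktheta (f l.1).
  by case: l.2; rewrite ?ktheta_star.
case: w => l s; rewrite /iev /= -hl; move: (if l.2 then _ else _) => a.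
by elim: s a => [|x s IH] a //=; rewrite -hl -ktheta_mul IH.
Qed.

Lemma kel_isat s : isat (@wmul 3) (@wstar 3) (@inK 3) s -> isat kmul kstar (fun _ => True) s.
Proof.
move=> h f _; apply: ktheta_inj; rewrite !ktheta_iev; apply: h => i.
exact: ktheta_inK.
Qed.

(** * Identities of the wire monoid *)

Lemma pigeonhole3 (T : finType) (f : nat -> T) :
  exists i j l, [/\ i < j, j < l, l <= 2 * #|T|, f i = f j & f j = f l].
Proof.
pose N := (2 * #|T|).+1; pose fib t := [set i : 'I_N | f i == t].
have [t ht] : exists t, 2 < #|fib t|.
  apply/existsP; apply: contraT; rewrite negb_exists => /forallP h.
  have : \sum_(t : T) #|fib t| <= \sum_(t : T) 2.
    by apply: leq_sum => t _; rewrite leqNgt.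
  rewrite (_ : \sum_(t : T) #|fib t| = N); first by rewrite sum_nat_const mulnC ltnn.
  rewrite -[RHS]card_ord -sum1_card (partition_big (fun i : 'I_N => f i) predT) //=.
  by apply: eq_bigr => t _; rewrite -sum1_card; apply: eq_bigl => i; rewrite inE.
case/card_gt2P: ht => x [y [z [[]]]]; rewrite !inE.
move=> /eqP hx /eqP hy /eqP hz [hxy hyz hzx].
have lex := ltn_ord x; have ley := ltn_ord y; have lez := ltn_ord z.
rewrite -!(inj_eq val_inj) /= in hxy hyz hzx.
case: (ltngtP x y) hxy => // hxy _; case: (ltngtP y z) hyz => // hyz _;
  case: (ltngtP z x) hzx => // hzx _; try lia.
- by exists x, y, z; split; rewrite ?hx ?hy ?hz.
- by exists z, x, y; split; rewrite ?hx ?hy ?hz.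
- by exists x, z, y; split; rewrite ?hx ?hy ?hz.
- by exists y, z, x; split; rewrite ?hx ?hy ?hz.
- by exists y, x, z; split; rewrite ?hx ?hy ?hz.
- by exists z, y, x; split; rewrite ?hx ?hy ?hz.
Qed.

Definition segment (T : Type) (w : nat -> T) (i j : nat) : seq T :=
  [seq w k | k <- iota i (j - i)].

Lemma segment_cat (T : Type) (w : nat -> T) i j l :
  i <= j -> j <= l -> segment w i l = segment w i j ++ segment w j l.
Proof.
move=> hij hjl; rewrite /segment -map_cat; congr map.
by rewrite (_ : l - i = (j - i) + (l - j)) ?iotaD ?subnKC //; lia.
Qed.

Section WireAction.
Variables (n : nat) (B : Type).
Local Notation X := {ffun pts n -> pts n}.

Definition step (g : B -> X) (p : X) (b : B) : X := (wmul (p, 0) (g b, 0)).1.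

Lemma wmulE (a b : Welt n) : wmul a b =
  ((wmul (a.1, 0) (b.1, 0)).1, a.2 + b.2 + (wmul (a.1, 0) (b.1, 0)).2).
Proof. by []. Qed.

Lemma foldl_wmul (f : B -> Welt n) (p : X) (d : nat) (s : seq B) :
  foldl (fun a b => wmul a (f b)) (p, d) s =
  (foldl (step (fun b => (f b).1)) p s,
   d + (foldl (fun a b => wmul a (f b)) (p, 0) s).2).
Proof.
elim: s p d => [|b s IH] p d; first by rewrite /= addn0.
rewrite /= !(wmulE _ (f b)) !(IH _ (_ + _)) /=; congr (_, _); lia.
Qed.

(** From the wire state reached after [r], both [p] and [q] are loops, so each adds the same number
    of circles in either order. *)
Lemma foldl_wmul_swap (f : B -> Welt n) x r p q :
  let st s := foldl (step (fun b => (f b).1)) x.1 s in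
  st (r ++ p) = st r -> st (r ++ p ++ q) = st r ->
  foldl (fun a b => wmul a (f b)) x (r ++ p ++ q) =
  foldl (fun a b => wmul a (f b)) x (r ++ q ++ p).
Proof.
case: x => x d /=; rewrite !foldl_cat => hp; rewrite hp => hq.
rewrite (foldl_wmul f x); move: hp hq; set y := foldl _ x r => hp hq.
pose c s := (foldl (fun a b => wmul a (f b)) (y, 0) s).2.
have E e s : foldl (fun a b => wmul a (f b)) (y, e) s =
    (foldl (step (fun b => (f b).1)) y s, e + c s) := foldl_wmul f y e s.
by rewrite E hp E hq E hq E hp addnAC.
Qed.
End WireAction.

Lemma wire_identity (n K : nat) : exists M, forall w : nat -> nat, (forall k, w k < K) ->
  exists i j l, [/\ 0 < i, i < j, j < l, l <= M &
    sat (@wmul n) (@wvalid n)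
      ((w 0, segment w 1 i ++ segment w i j ++ segment w j l),
       (w 0, segment w 1 i ++ segment w j l ++ segment w i j))].
Proof.
case: K => [|K]; first by exists 0 => w /(_ 0).
pose X := {ffun pts n -> pts n}; pose G := {ffun 'I_K.+1 -> X}.
(* A state in [T] records the wire part of a prefix under all substitutions at once, so one
   coincidence serves them all. *)
pose T := {ffun G -> X}.
exists (2 * #|{: T}|).+1 => w hw.
pose st k : T := [ffun g : G =>
  foldl (step (fun b => g (inord b))) (g (inord (w 0))) (segment w 1 k.+1)].
have [i [j [l [hij hjl hl eij ejl]]]] := pigeonhole3 st.
exists i.+1, j.+1, l.+1; split=> // f _; rewrite /ev /=.
pose g : G := [ffun b : 'I_K.+1 => (f b).1].
have stE k : st k g = foldl (step (fun b => (f b).1)) (f (w 0)).1 (segment w 1 k.+1).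
  rewrite ffunE ffunE inordK //; move: (f (w 0)).1 => x.
  rewrite /segment; elim: (iota _ _) x => //= a s IH x.
  by rewrite IH /step ffunE inordK.
apply: foldl_wmul_swap; rewrite ?catA -?segment_cat -?stE //; try lia.
  by rewrite eij.
by rewrite eij ejl.
Qed.

(** * Consequences of the identities of the Kauffman monoid *)

Section KauffmanEquivalence.
Variable B : eqType.
Implicit Types (u v s : seq B) (Y : pred B).

Definition kprod (g : B -> kel) s : kel := foldr (fun b a => kmul (g b) a) kone s.

Definition keq u v := forall g, kprod g u = kprod g v.

Lemma kprod_cat g u v : kprod g (u ++ v) = kmul (kprod g u) (kprod g v).
Proof. by elim: u => [|b u IH] /=; rewrite ?kmul1 // IH kmulA. Qed.

(** Deleting letters amounts to substituting the identity element for them. *)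
Lemma keq_filter Y u v : keq u v -> keq (filter Y u) (filter Y v).
Proof.
move=> h g; have hY s : kprod g (filter Y s) = kprod (fun b => if Y b then g b else kone) s.
  by elim: s => //= b s <-; case: (Y b); rewrite ?kmul1.
by rewrite !hY.
Qed.

Lemma keq_perm u v : keq u v -> perm_eq u v.
Proof.
move=> h; apply/allP=> x _; apply/eqP.
have hc s : kprod (fun b => (nat_of_bool (b == x), None)) s = (count_mem x s, None).
  by elim: s => //= b s ->.
by have := h (fun b => (nat_of_bool (b == x), None)); rewrite !hc; case.
Qed.

(** The number of circles closed when each letter [b] is sent to e_ij with [i = I b] and
    [j = J b]. *)
Fixpoint matches (I J : B -> bool) x s : nat :=
  if s is y :: s' then (J x == I y) + matches I J y s' else 0.

Fixpoint pairs (a b : B) x s : nat :=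
  if s is y :: s' then ((x == a) && (y == b)) + pairs a b y s' else 0.

Lemma kprodE I J x s : kprod (fun b => (0, Some (I b, J b))) (x :: s) =
  (matches I J x s, Some (I x, J (last x s))).
Proof.
elim: s x => [|y s IH] x //.
by rewrite -[LHS]/(kmul _ (kprod _ (y :: s))) IH /kmul /= add0n addnC.
Qed.

(* Inclusion-exclusion over the four choices of outer indices isolates the pair [ab]. *)
Lemma pairs_matches a b x s :
  matches (pred1 b) (pred1 a) x s + matches pred0 pred0 x s =
  matches pred0 (pred1 a) x s + matches (pred1 b) pred0 x s + 2 * pairs a b x s.
Proof.
elim: s x => [|y s IH] x //=; have := IH y.
by case: (x == a); case: (y == b) => /=; lia.
Qed.

Lemma keq_pairs a b x u y v : keq (x :: u) (y :: v) -> pairs a b x u = pairs a b y v.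
Proof.
move=> h; have hm I J : matches I J x u = matches I J y v.
  by have := h (fun b => (0, Some (I b, J b))); rewrite !kprodE => -[].
by have := pairs_matches a b x u; have := pairs_matches a b y v; rewrite !hm; lia.
Qed.

Lemma pairsP a b x s :
  reflect (exists s1 s2, x :: s = s1 ++ a :: b :: s2) (0 < pairs a b x s).
Proof.
apply: (iffP idP) => [|[s1 [s2]]].
  elim: s x => [|y s IH] x //=; rewrite addn_gt0 => /orP[|/IH[s1 [s2 ->]]].
    by case: andP => // -[/eqP-> /eqP->] _; exists [::], s.
  by exists (x :: s1), s2.
elim: s1 x s => [|c s1 IH] x s /= [-> ->]; first by rewrite /= !eqxx.
by case: s1 IH => [|d s1] IH; rewrite /= addn_gt0 (IH _ _ erefl) orbT.
Qed.

(** The upper index of a product of hooks is that of its first factor, so an index marking [x]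
    detects the first letter. The lower index does the same for the last letter. *)
Lemma keq_head x u y v : keq (x :: u) (y :: v) -> x = y.
Proof.
move=> h; have := h (fun b => (0, Some (b == x, b == x))).
by rewrite !(kprodE (fun b => b == x) (fun b => b == x)) eqxx => -[_ /esym/eqP].
Qed.

Lemma keq_last x u y v : keq (rcons u x) (rcons v y) -> x = y.
Proof.
move=> h; have hl I J s z : (kprod (fun b => (0, Some (I b, J b))) (rcons s z)).2 =
    Some (I (head z s), J z).
  by case: s => [|c s]; rewrite ?rcons_cons kprodE ?last_rcons.
have := congr1 snd (h (fun b => (0, Some (b == x, b == x)))).
by rewrite (hl (fun b => b == x) (fun b => b == x)) (hl (fun b => b == x) (fun b => b == x))
  eqxx => -[_ /esym/eqP].
Qed.

Lemma filter_split Y s a s1 s2 : filter Y s = s1 ++ a :: s2 ->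
  exists t1 t2, [/\ s = t1 ++ a :: t2, filter Y t1 = s1 & filter Y t2 = s2].
Proof.
elim: s s1 => [|c s IH] s1 /=; first by case: s1.
case: ifP => [Yc|nYc]; last first.
  by case/IH=> t1 [t2 [-> h1 h2]]; exists (c :: t1), t2; split=> //=; rewrite nYc.
case: s1 => [[-> <-]|d s1 [<- /IH[t1 [t2 [-> <- <-]]]]]; first by exists [::], s.
by exists (c :: t1), t2; split=> //=; rewrite Yc.
Qed.

Lemma filter_nil_nth Y s x0 i : filter Y s = [::] -> i < size s -> ~~ Y (nth x0 s i).
Proof.
move=> h hi; apply/negP=> Yi; have : nth x0 s i \in filter Y s.
  by rewrite mem_filter Yi mem_nth.
by rewrite h.
Qed.

Lemma filter_take_nil Y s x0 k : k <= size s -> (forall l, l < k -> ~~ Y (nth x0 s l)) ->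
  filter Y (take k s) = [::].
Proof.
move=> hk h; apply/eqP; rewrite -size_eq0 size_filter -leqn0 leqNgt -has_count.
apply/(has_nthP x0) => -[l]; rewrite size_takel // => hl.
by rewrite nth_take // (negbTE (h l hl)).
Qed.

Lemma filter_drop_nil Y s x0 k : (forall l, k <= l -> l < size s -> ~~ Y (nth x0 s l)) ->
  filter Y (drop k s) = [::].
Proof.
move=> h; apply/eqP; rewrite -size_eq0 size_filter -leqn0 leqNgt -has_count.
apply/(has_nthP x0) => -[l]; rewrite size_drop => hl.
by rewrite nth_drop; apply/negP; apply: h; lia.
Qed.

Section Positions.
Variables (x0 : B) (u v : seq B) (Y : pred B).
Hypothesis huv : keq u v.

Lemma keq_first_pos k : k < size v -> Y (nth x0 v k) ->
  (forall l, l < k -> ~~ Y (nth x0 v l)) ->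
  exists j, [/\ j < size u, nth x0 u j = nth x0 v k &
                forall l, l < j -> ~~ Y (nth x0 u l)].
Proof.
move=> hk Yk hl.
have ev : filter Y v = nth x0 v k :: filter Y (drop k.+1 v).
  rewrite -{1}(cat_take_drop k v) filter_cat (filter_take_nil (x0 := x0)) ?(ltnW hk) //=.
  by rewrite (drop_nth x0 hk) /= Yk.
have := keq_filter Y huv; rewrite ev; case hu: (filter Y u) => [|a s] h.
  by have := perm_size (keq_perm h).
have [t1 [t2 [-> h1 _]]] := filter_split (s1 := [::]) hu.
exists (size t1); split; first by rewrite size_cat /=; lia.
  by rewrite nth_cat ltnn subnn /= (keq_head h).
by move=> l hl'; rewrite nth_cat hl'; apply: filter_nil_nth.
Qed.

Lemma keq_last_pos k : k < size v -> Y (nth x0 v k) ->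
  (forall l, k < l -> l < size v -> ~~ Y (nth x0 v l)) ->
  exists j, [/\ j < size u, nth x0 u j = nth x0 v k &
                forall l, j < l -> l < size u -> ~~ Y (nth x0 u l)].
Proof.
move=> hk Yk hl.
have ev : filter Y v = rcons (filter Y (take k v)) (nth x0 v k).
  rewrite -{1}(cat_take_drop k v) filter_cat (drop_nth x0 hk) /= Yk.
  by rewrite (filter_drop_nil (x0 := x0)) // cats1.
have := keq_filter Y huv; rewrite ev.
case/lastP hu: (filter Y u) => [|s a] h.
  by have := perm_size (keq_perm h); rewrite size_rcons.
rewrite -cats1 in hu.
have [t1 [t2 [-> _ h2]]] := filter_split hu.
exists (size t1); split; first by rewrite size_cat /=; lia.
  by rewrite nth_cat ltnn subnn /= (keq_last h).
move=> l hl1; rewrite size_cat /= => hl2; rewrite nth_cat ltnNge (ltnW hl1) /=.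
case: (l - size t1) (subnKC (ltnW hl1)) => [|d] e; first by lia.
by rewrite /=; apply: filter_nil_nth => //; lia.
Qed.

(** Deleting the letters outside [Y] makes the two positions neighbours, and the reduced words have
    the same adjacent pairs. The pair reappears in [u] at positions that may differ. *)
Lemma keq_adjacent_pos k m : k < m -> m < size v -> Y (nth x0 v k) -> Y (nth x0 v m) ->
  (forall l, k < l -> l < m -> ~~ Y (nth x0 v l)) ->
  exists i j, [/\ i < j, j < size u, nth x0 u i = nth x0 v k, nth x0 u j = nth x0 v m &
                  forall l, i < l -> l < j -> ~~ Y (nth x0 u l)].
Proof.
move=> hkm hm Yk Ym hl.
have ev : filter Y v = filter Y (take k v) ++ nth x0 v k :: nth x0 v m :: filter Y (drop m.+1 v).
  rewrite -{1}(cat_take_drop k v) filter_cat (drop_nth x0) /= ?Yk; last by lia.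
  congr (_ ++ _ :: _); rewrite -{1}(cat_take_drop (m - k.+1) (drop k.+1 v)) filter_cat.
  rewrite (filter_take_nil (x0 := x0)) /=; last first.
  - by move=> l hl'; rewrite nth_drop; apply: hl; lia.
  - by rewrite size_drop; lia.
  by rewrite drop_drop subnK // (drop_nth x0 hm) /= Ym.
have := keq_filter Y huv; case hu: (filter Y u) => [|a s]; case hv: (filter Y v) => [|b t] h;
  try by [have := perm_size (keq_perm h)|rewrite ev in hv; case: (filter _ _) hv].
have : 0 < pairs (nth x0 v k) (nth x0 v m) b t.
  by apply/pairsP; rewrite -hv ev; do 2!eexists.
rewrite -(keq_pairs _ _ h) => /pairsP[s1 [s2]]; rewrite -hu => hs.
have [t1 [t2 [-> _ h2]]] := filter_split hs.
have [t3 [t4 [-> h3 _]]] := filter_split (s1 := [::]) h2.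
exists (size t1), (size t1 + (size t3).+1); split; first by lia.
- by rewrite size_cat /= size_cat /=; lia.
- by rewrite nth_cat ltnn subnn.
- by rewrite nth_cat ltnNge leq_addr /= addKn /= nth_cat ltnn subnn.
move=> l hl1 hl2; rewrite nth_cat ltnNge (ltnW hl1) /=.
case: (l - size t1) (subnKC (ltnW hl1)) => [|d] e; first by lia.
have hd : d < size t3 by lia.
by rewrite /= nth_cat hd; apply: filter_nil_nth.
Qed.
End Positions.
End KauffmanEquivalence.

Lemma keq_flatten (B C : eqType) (ex : B -> seq C) (u v : seq B) :
  keq u v -> keq (flatten (map ex u)) (flatten (map ex v)).
Proof.
move=> h g; have hs s : kprod g (flatten (map ex s)) = kprod (fun b => kprod g (ex b)) s.
  by elim: s => //= b s IH; rewrite kprod_cat IH.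
by rewrite !hs.
Qed.

(** * A square-free fixed point *)

Definition alpha := (nat * nat)%type.

(* [letter r 0, letter r 1, ...] is the fixed point of the morphism
   [gamma (s, j) = (0, s) (1, j) (2, s) (3, j) ...] (with [r] letters); the argument
   [f] of [digit] is fuel. *)
Fixpoint digit (r f k : nat) : nat :=
  if f is f'.+1 then if odd (k %% r) then digit r f' (k %/ r) else (k %/ r) %% r else 0.

Definition letter (r k : nat) : alpha := (k %% r, digit r k.+1 k).

(* Any two adjacent letters inside the block [gamma (s, j)] reveal both [s] and [j]. *)
Definition parent (a b : alpha) : alpha := if odd a.1 then (b.2, a.2) else (a.2, b.2).

(** For [i > 0] a letter of type [i] in the fixed point has its predecessor in the same block, so
    the pair reveals where the block comes from. The first letter of a word lacks a predecessor and
    contributes nothing. *)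
Fixpoint desub_from (i : nat) (a : alpha) (s : seq alpha) : seq alpha :=
  if s is b :: s' then
    if b.1 == i then parent a b :: desub_from i b s' else desub_from i b s'
  else [::].

Definition desub (i : nat) (s : seq alpha) : seq alpha :=
  if s is a :: s' then desub_from i a s' else [::].

Lemma size_desub_from i a s : size (desub_from i a s) <= size s.
Proof. by elim: s a => //= b s IH a; case: ifP => _ /=; have := IH b; lia. Qed.

(** Only the pair straddling the cut could be lost, and it counts only if [t] starts with type
    [i]. *)
Lemma desub_cat i s t : (head (0, 0) t).1 != i -> desub i (s ++ t) = desub i s ++ desub i t.
Proof.
case: s => // a s; case: t => [|b t] /= hb; first by rewrite !cats0.
by elim: s a => [|c s IH] a /=; rewrite ?(negbTE hb) // IH; case: ifP.
Qed.

Lemma desub_nil i x0 s k : desub i s = [::] -> k.+1 < size s -> (nth x0 s k.+1).1 != i.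
Proof.
case: s => //= a s; elim: s a k => //= b s IH a k; case: ifP => // hb h.
by case: k => [|k]; rewrite ?hb // => hk; apply: (IH b k).
Qed.

(** Equal types make both words emit parents at the same positions, so equal outputs agree position
    by position. *)
Lemma desub_inj_pos i x0 s t k : size s = size t ->
  (forall l, l < size s -> (nth x0 s l).1 = (nth x0 t l).1) ->
  desub i s = desub i t -> k.+1 < size s -> (nth x0 s k.+1).1 = i ->
  parent (nth x0 s k) (nth x0 s k.+1) = parent (nth x0 t k) (nth x0 t k.+1).
Proof.
case: s t => [|a s] [|b t] //= [] hsz hty h hk hi.
elim: s t a b k hsz hty h hk hi => [|a' s IH] [|b' t] a b k //= [] hsz hty h hk hi.
have hab : a'.1 = b'.1 by have := hty 1 isT.
have hty' l : l < (size s).+1 -> (nth x0 (a' :: s) l).1 = (nth x0 (b' :: t) l).1.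
  by move=> hl; apply: (hty l.+1).
rewrite -hab in h.
case: k hk hi => [|k] /= hk hi.
  by move: h; rewrite hi eqxx => -[].
by apply: IH => //; move: h; case: ifP => // _ [].
Qed.

Section Word.
Variable r : nat.
Hypothesis r_gt1 : 1 < r.
Local Notation letter := (letter r).

Lemma digit_fuel f k : k < f -> digit r f k = digit r k.+1 k.
Proof.
elim/ltn_ind: k f => k IH [|f] // hf; rewrite [LHS]/= [RHS]/=.
case: ifP => // hodd; have hk : k %/ r < k.
  by apply: ltn_Pdiv => //; case: k hodd {IH hf} => //; rewrite mod0n.
by rewrite IH // ?(IH _ hk k) //; lia.
Qed.

(** The fixed point equation: position [k] has type [k %% r] in the image of the letter at position
    [k %/ r]. *)
Lemma letter2E k : (letter k).2 =
  if odd (k %% r) then (letter (k %/ r)).2 else (letter (k %/ r)).1.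
Proof.
rewrite /letter [LHS]/=; case: ifP => // hodd; apply: digit_fuel.
by apply: ltn_Pdiv => //; case: k hodd => //; rewrite mod0n.
Qed.

Lemma letter_eq k l : k %% r = l %% r -> letter (k %/ r) = letter (l %/ r) ->
  letter k = letter l.
Proof.
move=> hm hd; apply: injective_projections; first exact: hm.
by rewrite (letter2E k) (letter2E l) hm hd.
Qed.

Lemma divmodD a d : a %% r + d < r -> (a + d) %/ r = a %/ r /\ (a + d) %% r = a %% r + d.
Proof.
move=> h; have r_gt0 : 0 < r by lia.
rewrite (_ : a + d = a %/ r * r + (a %% r + d)); last by rewrite addnA -divn_eq.
by rewrite divnMDl // modnMDl (divn_small h) (modn_small h) addn0.
Qed.

Lemma divE k q s : k = q * r + s -> s < r -> k %/ r = q.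
Proof. by move=> -> hs; rewrite divnMDl ?divn_small ?addn0 //; apply: leq_ltn_trans hs. Qed.

Lemma modE k q s : k = q * r + s -> s < r -> k %% r = s.
Proof. by move=> -> hs; rewrite modnMDl modn_small. Qed.

Lemma parent_letter k : (k %% r).+1 < r ->
  parent (letter k) (letter k.+1) = letter (k %/ r).
Proof.
move=> h; have [hd hm] : (k.+1 %/ r = k %/ r /\ k.+1 %% r = k %% r + 1).
  by rewrite -addn1; apply: divmodD; lia.
rewrite /parent (letter2E k) (letter2E k.+1) hd hm addn1.
by case: (letter (k %/ r)) => a b /=; case: (odd _).
Qed.

Definition factor (x : seq alpha) := exists k, x = [seq letter j | j <- iota k (size x)].

(** [(k + (r - i)) %/ r] is the first block whose letter of type [i] lies strictly after position
    [k]. *)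
Lemma desub_letters i k n : 0 < i < r -> exists m,
  desub_from i (letter k) [seq letter j | j <- iota k.+1 n] =
  [seq letter j | j <- iota ((k + (r - i)) %/ r) m].
Proof.
move=> hi; elim: n k => [|n IH] k; first by exists 0.
have [m hm] := IH k.+1; rewrite /= hm.
have hk := divn_eq k r; have hr : k %% r < r by rewrite ltn_mod; lia.
move: (k %/ r) (k %% r) hk hr (@parent_letter k) => q s hk hr hpar.
have hq1 : s.+1 < r -> k.+1 %% r = s.+1 by apply: (@modE _ q); lia.
case: eqP => hki.
  have {}hki : s.+1 = i.
    case: (ltnP s.+1 r) => h; first by rewrite -hki hq1.
    by move: hki; rewrite (@modE _ q.+1 0); lia.
  exists m.+1; rewrite hpar; last by lia.
  by rewrite (@divE (k + (r - i)) q r.-1) ?(@divE (k.+1 + (r - i)) q.+1 0) //; lia.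
exists m; congr (map _ (iota _ _)).
have hki' : s.+1 <> i by move=> e; apply: hki; rewrite -e hq1 //; lia.
case: (ltnP s.+1 i) => h.
  by rewrite (@divE (k + _) q (s + (r - i))) ?(@divE (k.+1 + _) q (s + (r - i)).+1); lia.
by rewrite (@divE (k + _) q.+1 (s - i)) ?(@divE (k.+1 + _) q.+1 (s - i).+1); lia.
Qed.

Lemma factor_desub i x : 0 < i < r -> factor x -> factor (desub i x).
Proof.
case: x => [|a s] hi [k] /=; first by exists 0.
case=> -> ->; have [m ->] := desub_letters k (size s) hi.
by exists ((k + (r - i)) %/ r); rewrite size_map size_iota.
Qed.

(** Types force [r] to divide the period of a square. Desubstituting by a type that does not start
    [z] gives a shorter square, empty by induction, although [z] is long enough to contain that type
    after its first letter. *)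
Lemma square_free z : 2 < r -> factor (z ++ z) -> z = [::].
Proof.
move=> r_gt2; have [n hn] := ubnP (size z); elim: n z hn => // n IH z hn hz.
case hz0: z => [//|a s]; exfalso.
have z_gt0 : 0 < size z by rewrite hz0.
have [k hk] := hz; rewrite size_cat in hk.
have ez j : j < size z -> nth (0, 0) z j = letter (k + j).
  move=> hj; have := congr1 (fun s => nth (0, 0) s j) hk.
  by rewrite nth_cat hj (nth_map 0) ?size_iota ?nth_iota //; lia.
have ez' j : j < size z -> nth (0, 0) z j = letter (k + (size z + j)).
  move=> hj; have := congr1 (fun s => nth (0, 0) s (size z + j)) hk.
  by rewrite nth_cat ltnNge leq_addr /= addKn (nth_map 0) ?size_iota ?nth_iota //; lia.
have hr : r <= size z.
  have := ez 0 z_gt0; rewrite (ez' 0 z_gt0) !addn0 => -[e _].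
  apply: dvdn_leq => //; move/eqP: e.
  by rewrite -{2}[k]addn0 eqn_modDl mod0n.
(* Of the types 1 and 2, at least one is not the type of the first letter. *)
have [i hi hki] : exists2 i, 0 < i <= 2 & k %% r != i.
  by case: (eqVneq (k %% r) 1) => h; [exists 2|exists 1]; rewrite ?h.
have hir : 0 < i < r by lia.
have hh : (head (0, 0) z).1 != i by rewrite -nth0 ez // addn0.
have := IH (desub i z); rewrite -desub_cat // => /(_ _ (factor_desub hir hz)).
have -> : size (desub i z) < n.
  by rewrite hz0 /=; have := size_desub_from i a s; move: hn; rewrite hz0 /=; lia.
move/(_ isT) => hnil.
have [d hd] : exists2 d, d.+1 < r & (k + d.+1) %% r = i.
  have kr : k %% r < r by rewrite ltn_mod; lia.
  have hk' := divn_eq k r.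
  case: (ltnP (k %% r) i) => h.
    by exists (i - k %% r).-1; [|apply: (@modE _ (k %/ r))]; lia.
  by exists (i + r - k %% r).-1; [|apply: (@modE _ (k %/ r).+1)]; lia.
have := desub_nil (0, 0) hnil (leq_trans hd hr).
by rewrite ez; [move=> /eqP h hk'|lia].
Qed.

End Word.

(** * Substitutions into the fixed point *)

Section Recover.
(** Used with [B] the pairs of a variable and an offset in its image: [val] reads the letter there,
    and [pred_of] lowers the offset. *)
Variables (r : nat) (B : eqType) (val : B -> alpha) (pred_of : B -> B) (U V : seq B) (k0 i : nat).
Hypothesis hi : 0 < i < r.
Hypothesis hUV : keq U V.
Variable x0 : B.
Local Notation n := (size U).
Hypothesis hU : forall j, j < n -> val (nth x0 U j) = letter r (k0 + j).
Hypothesis hpred : forall j, j < n -> (val (nth x0 U j)).1 = i ->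
  0 < j /\ nth x0 U j.-1 = pred_of (nth x0 U j).
Hypothesis hD : desub i (map val U) = desub i (map val V).

Let r_gt1 : 1 < r. Proof. lia. Qed.
Let szV : size V = n. Proof. exact/esym/perm_size/keq_perm. Qed.

Lemma typeU j : j < n -> (val (nth x0 U j)).1 = (k0 + j) %% r.
Proof. by move=> hj; rewrite hU. Qed.

Lemma adjacentV k : k.+1 < n ->
  exists j, [/\ j.+1 < n, nth x0 U j = nth x0 V k & nth x0 U j.+1 = nth x0 V k.+1].
Proof.
move=> hk; have [| | | | |a [b [hab hb ha' hb' hno]]] :=
  @keq_adjacent_pos _ x0 U V predT hUV k k.+1 => //; rewrite ?szV //; first by lia.
exists a; have e : b = a.+1; last by rewrite -e.
by case: (ltnP a.+1 b) => h; [have := hno a.+1 (leqnn _) h|lia].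
Qed.

(** Types grow by one modulo [r] along [U], and the first letter and the adjacent pairs of [V] come
    from [U]. *)
Lemma typeV k : k < n -> (val (nth x0 V k)).1 = (k0 + k) %% r.
Proof.
elim: k => [|k IH] hk.
  have [| | |j [hj <- hno]] := @keq_first_pos _ x0 U V predT hUV 0 => //; rewrite ?szV //.
  by case: j hj hno => [|j] hj hno; [rewrite typeU|have := hno 0 isT].
have [j [hj e1 e2]] := adjacentV hk.
rewrite -e2 typeU // !addnS -addn1 -[in RHS]addn1 -modnDml -[in RHS]modnDml.
by rewrite -IH ?(ltnW hk) // -e1 typeU //; lia.
Qed.

(** An element of type [i] determines its predecessor, in [U] by [hpred] and in [V] because adjacent
    pairs of [V] occur in [U]. So both positions carry the same pair, whose parent [hD] compares
    with the one at position [k] of [U]. *)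
Lemma blockE j k : 0 < j -> j < n -> 0 < k -> k < n -> nth x0 U j = nth x0 V k ->
  (k0 + k) %% r = i -> letter r ((k0 + j) %/ r) = letter r ((k0 + k) %/ r).
Proof.
move=> hj hjn hk hkn e hki.
have hji : (k0 + j) %% r = i by rewrite -typeU // e typeV.
case: j hj hjn e hji => // j _ hjn e hji; case: k hk hkn e hki => // k _ hkn e hki.
have parentU l : l.+1 < n -> (k0 + l.+1) %% r = i ->
    parent (val (nth x0 U l)) (val (nth x0 U l.+1)) = letter r ((k0 + l.+1) %/ r).
  move=> hl hli; rewrite !hU //; last by lia.
  have hm := divn_eq (k0 + l.+1) r; rewrite hli in hm.
  rewrite addnS in hm *; set q := _ %/ r in hm *.
  rewrite parent_letter //; last by rewrite (@modE r _ q i.-1); lia.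
  by congr (letter r _); apply: (@divE r _ _ i.-1); lia.
rewrite -parentU // -parentU //.
have [l [hl e1 e2]] := adjacentV hkn.
have hli : (val (nth x0 U l.+1)).1 = i by rewrite e2 typeV.
have [_ /= e3] := hpred hl hli; have [_ /= e4] := hpred hjn (etrans (typeU hjn) hji).
rewrite e4 e -e2 -e3 e1 e2.
have := @desub_inj_pos i (val x0) (map val U) (map val V) k.
rewrite !size_map szV !(nth_map x0) ?szV //; try lia.
move=> -> //; first by move=> m hm; rewrite !(nth_map x0) ?szV // typeU // typeV.
by rewrite typeU.
Qed.

(* The letter at position [k] of [V] is compared with the letter of type [i] in the same
   block, or with an end of the word when that letter falls outside: after deleting
   everything but the letters of type [i] and this one, the two are adjacent in [V],
   hence also somewhere in [U]. *)
Lemma recover_pos k : k < n -> val (nth x0 V k) = val (nth x0 U k).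
Proof.
move=> hk; rewrite hU //.
(* A letter is determined by its type and by the letter its block comes from. *)
suff [j hj [e hb]] : exists2 j, j < n & nth x0 U j = nth x0 V k /\
    letter r ((k0 + j) %/ r) = letter r ((k0 + k) %/ r).
  by rewrite -e hU //; apply: letter_eq => //; rewrite -typeU // e typeV.
pose t := (k0 + k) %% r; have tr : t < r by rewrite ltn_mod; lia.
pose Y b := ((val b).1 == i) || (b == nth x0 V k).
have YU j : j < n -> (k0 + j) %% r = i -> Y (nth x0 U j).
  by move=> hj h; rewrite /Y typeU // h eqxx.
have nYV l : l < n -> (k0 + l) %% r <> i -> (k0 + l) %% r <> t -> ~~ Y (nth x0 V l).
  move=> hl h1 h2; rewrite /Y typeV //; apply/norP; split; apply/eqP=> // e.
  by apply: h2; rewrite -typeV // e typeV.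
have Yk : Y (nth x0 V k) by rewrite /Y eqxx orbT.
have tU j : j < n -> nth x0 U j = nth x0 V k -> (k0 + j) %% r = t.
  by move=> hj e; rewrite -typeU // e typeV.
have hkt : k0 + k = (k0 + k) %/ r * r + t := divn_eq _ _.
move: ((k0 + k) %/ r) hkt => q hkt.
case: (ltngtP t i) => hti.
(* The letter of type [i] in the block of [k] follows position [k], or lies beyond the end. *)
- case: (ltnP (k + (i - t)) n) => hm.
  + have hmi : (k0 + (k + (i - t))) %% r = i by apply: (@modE r _ q); lia.
    have [| | | | |a [b [hab hb ha' hb' hno]]] :=
      @keq_adjacent_pos _ x0 U V Y hUV k (k + (i - t)) => //; rewrite ?szV //; first by lia.
      by rewrite /Y typeV // hmi eqxx.
      move=> l h1 h2; apply: nYV; first by lia.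
        by rewrite (@modE r _ q (t + (l - k))); lia.
      by rewrite (@modE r _ q (t + (l - k))); lia.
    have ta := tU a (ltn_trans hab hb) ha'.
    have hbi : (k0 + b) %% r = i by rewrite -typeU // hb' typeV.
    have hat := divn_eq (k0 + a) r; rewrite ta in hat.
    (* A smaller [b] has the wrong type; a larger one leaves a letter of type [i] in between. *)
    have eb : b = a + (i - t).
      case: (ltngtP b (a + (i - t))) => // h.
        by move: hbi; rewrite (@modE r _ ((k0 + a) %/ r) (t + (b - a))); lia.
      have := hno (a + (i - t)); rewrite YU; [by move=> /(_ _ h); lia|lia|].
      by apply: (@modE r _ ((k0 + a) %/ r)); lia.
    exists a; first by lia.
    split=> //; have := @blockE b (k + (i - t)).
    rewrite (@divE r (k0 + (k + (i - t))) q i); [|lia..].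
    by rewrite (@divE r (k0 + b) ((k0 + a) %/ r) i); [|lia..]; apply=> //; lia.
  + have [| | |j [hj e hno]] := @keq_last_pos _ x0 U V Y hUV k => //; rewrite ?szV //.
      move=> l h1 h2; apply: nYV => //;
        by rewrite (@modE r _ q (t + (l - k))); lia.
    have tj := tU j hj e; have hjt := divn_eq (k0 + j) r; rewrite tj in hjt.
    (* Both [j] and [k] lie within [i - t] of the end and have the same type, so they coincide. *)
    exists j => //; split=> //; suff -> : j = k by rewrite (@divE r (k0 + k) q t).
    case: (ltngtP j k) => // h.
      case: (ltnP (j + (i - t)) n) => h'.
        have := hno (j + (i - t)); rewrite YU //; first by move=> /(_ _ h'); lia.
        by apply: (@modE r _ ((k0 + j) %/ r)); lia.
      suff : (k0 + k) %% r = t + (k - j) by rewrite (@modE r (k0 + k) q t); lia.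
      by apply: (@modE r _ ((k0 + j) %/ r)); lia.
    suff : (k0 + j) %% r = t + (j - k) by rewrite tj; lia.
    by apply: (@modE r _ q); lia.
(* The mirror case: the letter of type [i] precedes position [k], or lies before the start. *)
- case: (ltnP k (t - i)) => hm.
  + have [| | |j [hj e hno]] := @keq_first_pos _ x0 U V Y hUV k => //; rewrite ?szV //.
      move=> l h1; apply: nYV; rewrite ?(@modE r _ q (t - (k - l))); lia.
    have tj := tU j hj e; have hjt := divn_eq (k0 + j) r; rewrite tj in hjt.
    exists j => //; split=> //; suff -> : j = k by rewrite (@divE r (k0 + k) q t).
    case: (ltngtP j k) => // h.
      suff : (k0 + j) %% r = t - (k - j) by rewrite tj; lia.
      by apply: (@modE r _ q); lia.
    case: (ltnP j (t - i)) => h'.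
      suff : (k0 + k) %% r = t - (j - k) by rewrite (@modE r (k0 + k) q t); lia.
      by apply: (@modE r _ ((k0 + j) %/ r)); lia.
    have := hno (j - (t - i)); rewrite YU //; first by move=> /(_ _); lia.
      by lia.
    by apply: (@modE r _ ((k0 + j) %/ r)); lia.
  + have hmi : (k0 + (k - (t - i))) %% r = i by apply: (@modE r _ q); lia.
    have [| | | | |a [b [hab hb ha' hb' hno]]] :=
      @keq_adjacent_pos _ x0 U V Y hUV (k - (t - i)) k => //; rewrite ?szV //; first by lia.
      by rewrite /Y typeV // ?hmi ?eqxx //; lia.
      by move=> l h1 h2; apply: nYV; rewrite ?(@modE r _ q (t - (k - l))); lia.
    have tb := tU b hb hb'.
    have hai : (k0 + a) %% r = i by rewrite -typeU ?ha' ?typeV //; lia.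
    have hbt := divn_eq (k0 + b) r; rewrite tb in hbt.
    have hat := divn_eq (k0 + a) r; rewrite hai in hat.
    have ea : b = a + (t - i).
      case: (ltngtP b (a + (t - i))) => // h.
        by move: tb; rewrite (@modE r _ ((k0 + a) %/ r) (i + (b - a))); lia.
      have := hno (b - (t - i)); rewrite YU; [by move=> /(_ _); lia|lia|].
      by apply: (@modE r _ ((k0 + b) %/ r)); lia.
    (* Type [i] does not occur at position 0 of [U], so both letters have the predecessor that
       [blockE] requires. *)
    have a_gt0 : 0 < a by have [] := hpred (ltn_trans hab hb) (etrans (typeU (ltn_trans hab hb)) hai).
    have m_gt0 : 0 < k - (t - i).
      rewrite lt0n; apply/eqP=> e; rewrite e in hmi.
      by have [] := hpred (leq_ltn_trans (leq0n k) hk) (etrans (typeU (leq_ltn_trans (leq0n k) hk)) hmi).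
    exists b => //; split=> //; have := @blockE a (k - (t - i)).
    rewrite (@divE r (k0 + (k - (t - i))) q i); [|lia..].
    by rewrite (@divE r (k0 + b) ((k0 + a) %/ r) t); [|lia..]; apply=> //; lia.
- have k_gt0 : 0 < k.
    rewrite lt0n; apply/eqP=> e.
    have h0 : 0 < n by lia.
    by have [] := hpred h0 (etrans (typeU h0) _); rewrite // -e.
  have [j [hj e1 e2]] := @adjacentV k.-1 ltac:(lia).
  rewrite prednK // in e2; exists j.+1 => //; split=> //.
  by rewrite -(@divE r (k0 + k) q t) //; apply: blockE.
Qed.

Lemma recover : map val V = map val U.
Proof.
apply: (@eq_from_nth _ (val x0)); first by rewrite !size_map szV.
by move=> k; rewrite size_map szV => hk; rewrite !(nth_map x0) ?szV // recover_pos.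
Qed.
End Recover.

Section Main.
Variables (r : nat) (A : eqType).
Implicit Types (u v : seq A) (phi : A -> seq alpha).

Definition subst_word phi u := flatten [seq phi x | x <- u].

(** Each letter of the image remembers its origin. Being a substitution instance, this refinement
    preserves [keq]. *)
Definition expand phi u : seq (A * nat) :=
  flatten [seq [seq (x, o) | o <- iota 0 (size (phi x))] | x <- u].

Definition spell phi (b : A * nat) : alpha := nth (0, 0) (phi b.1) b.2.

Lemma map_spell phi u : map (spell phi) (expand phi u) = subst_word phi u.
Proof.
rewrite map_flatten -map_comp; congr flatten; apply: eq_map => x /=.
rewrite -map_comp -[RHS](mkseq_nth (0, 0)); exact: eq_map.
Qed.

Lemma expand_pred phi u x0 j x o : j < size (expand phi u) ->
  nth x0 (expand phi u) j = (x, o.+1) -> 0 < j /\ nth x0 (expand phi u) j.-1 = (x, o).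
Proof.
elim: u j => [|y u IH] j //; rewrite /expand /= -/(expand _ _) size_cat size_map size_iota.
rewrite !nth_cat !size_map !size_iota => hj; case: (ltnP j (size (phi y))) => hs.
  rewrite (nth_map 0) ?size_iota // nth_iota // => -[<- e].
  split; first by lia.
  rewrite ifT; last by lia.
  by rewrite (nth_map 0) ?size_iota ?nth_iota; [congr (_, _); lia|lia..].
move=> e; have [] := IH (j - size (phi y)) _ e; first by lia.
move=> h <-; split; first by lia.
by rewrite ifF; [congr nth; lia|lia].
Qed.

Lemma expand_mem phi u b : b \in expand phi u -> b.1 \in u.
Proof. by move=> /flattenP[s /mapP[x hx ->] /mapP[o _ ->]]. Qed.

(** No pair read by [desub] straddles two images; [i != 0] covers the default head of an empty
    tail. *)
Lemma desub_subst i phi u : (forall x, x \in u -> (head (0, 0) (phi x)).1 != i) -> i != 0 ->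
  desub i (subst_word phi u) = subst_word (fun x => desub i (phi x)) u.
Proof.
move=> + hi; elim: u => //= x u IH h.
rewrite /subst_word /= -/(subst_word _ _) desub_cat; last first.
  have {IH} : forall y, y \in u -> (head (0, 0) (phi y)).1 != i.
    by move=> y hy; apply: h; rewrite inE hy orbT.
  elim: u {h} => [|y u IH] h /=; first by rewrite eq_sym.
  rewrite /subst_word /=; have := h y (mem_head _ _).
  case: (phi y) => [_|a s //]; apply: IH => z hz; apply: h; by rewrite inE hz orbT.
by rewrite IH // => y hy; apply: h; rewrite inE hy orbT.
Qed.

Lemma substitution_determined u v phi : keq u v -> size u + 2 <= r ->
  factor r (subst_word phi u) -> subst_word phi v = subst_word phi u.
Proof.
move=> huv hr; have [N hN] := ubnP (size (subst_word phi u)).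
elim: N phi hN => // N IH phi hN hf.
have hmem : v =i u by move=> x; rewrite (perm_mem (keq_perm huv)).
have hUV : keq (expand phi u) (expand phi v) := keq_flatten _ huv.
case eU: (expand phi u) => [|x0 U'].
  have := perm_size (keq_perm hUV); rewrite -!map_spell eU /=.
  by case: (expand phi v).
(* There are [r - 1] positive types, and at most [size u <= r - 2] types start an image. *)
have [i hi hiu] : exists2 i, 0 < i < r & forall x, x \in u -> (head (0, 0) (phi x)).1 != i.
  have [|/allPn[i]] := boolP (all [in [seq (head (0, 0) (phi x)).1 | x <- u]] (iota 1 r.-1)).
    move/allP/(uniq_leq_size (iota_uniq _ _)); rewrite size_iota size_map; lia.
  rewrite mem_iota => hi hiu; exists i; first by lia.
  by move=> x hx; apply: contraNneq hiu => <-; apply: map_f.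
have hi0 : i != 0 by lia.
(* Desubstitution drops at least the first letter, so the induction hypothesis applies. *)
have hD : subst_word (fun x => desub i (phi x)) v = subst_word (fun x => desub i (phi x)) u.
  apply: IH; rewrite -desub_subst //; last by apply: factor_desub => //; lia.
  move: hN; rewrite -map_spell eU /=.
  by have := size_desub_from i (spell phi x0) (map (spell phi) U'); lia.
rewrite -!desub_subst // in hD; last by move=> x; rewrite hmem; apply: hiu.
have [k0 hk0] := hf.
rewrite -!map_spell in hD hk0 *.
apply: (@recover r _ _ (fun b => (b.1, b.2.-1)) _ _ k0 i hi hUV x0) => //.
- move=> j hj; rewrite -(nth_map _ (spell phi x0)) // hk0.
  by rewrite (nth_map 0) ?nth_iota ?size_iota ?size_map.
move=> j hj; case e: (nth x0 _ j) => [x [|o]] h; last exact: expand_pred.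
have : (x, 0) \in expand phi u by rewrite -e mem_nth.
by move/expand_mem/hiu; rewrite -nth0 h eqxx.
Qed.
End Main.

(** * Identities with involution *)

Definition klit (g : nat -> kel) (l : nat * bool) : kel :=
  if l.2 then kstar (g l.1) else g l.1.

Definition kieq (u v : seq (nat * bool)) := forall g, kprod (klit g) u = kprod (klit g) v.

Lemma isat_kieq s : isat kmul kstar (fun _ => True) s ->
  kieq (s.1.1 :: s.1.2) (s.2.1 :: s.2.2).
Proof.
have hf g (w : iword) : kprod (klit g) (w.1 :: w.2) = iev kmul kstar g w.
  case: w => l t; rewrite /iev [LHS]/= -/(klit g l); move: (klit g l) => a.
  by elim: t a => [|b t IH] a /=; rewrite ?kmulr1 // kmulA IH.
by move=> h g; rewrite !hf h.
Qed.

(** Apply the involution to both sides and replace [g] by its star. *)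
Lemma kieq_rev u v : kieq u v -> kieq (rev u) (rev v).
Proof.
have hr g w : kprod (klit g) (rev w) = kstar (kprod (klit (fun x => kstar (g x))) w).
  elim: w => [|l w IH] //; rewrite rev_cons -cats1 kprod_cat IH /= kmulr1 kstarM.
  by congr kmul; rewrite /klit; case: l.2; rewrite kstarK.
by move=> h g; rewrite !hr h.
Qed.

Lemma kieq_vars u v x : kieq u v -> (x \in map fst u) = (x \in map fst v).
Proof.
have hc w : kprod (klit (fun y => (nat_of_bool (y == x), None))) w = (count_mem x (map fst w), None).
  by elim: w => //= [[y []]] w ->.
move=> h; have := h (fun y => (nat_of_bool (y == x), None)).
by rewrite !hc -!has_pred1 !has_count => -[->].
Qed.

(* With [x] sent to the element [e_01], the word [x^k] contributes no circle,
   while any occurrence of [x^*] creates one or changes the outer indices. *)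
Lemma kprod_oriented (s : seq bool) :
  kprod (fun b => (0, Some (b, ~~ b))) s = (0, Some (false, true)) <->
  s <> [::] /\ true \notin s.
Proof.
elim: s => [|b s IH]; first by split=> // -[].
rewrite [kprod _ _]/= inE negb_or; case: b => /=.
  by split=> [|[]//]; case: (kprod _ s) => d [[i j]|].
case: s IH => [|c s] IH; first by split.
case hs: (kprod _ (c :: s)) IH => [d o] IH.
have ho : exists i j, o = Some (i, j).
  by have /(congr1 snd) := hs; rewrite kprodE /= => <-; do 2!eexists.
case: ho IH hs => i [j ->] IH hs; split=> [|[_ h]].
  rewrite /kmul /= => -[hd hj]; split=> //; apply IH; rewrite hj.
  by case: i hd {hs IH} => hd; congr (_, _); lia.
have [] : (d, Some (i, j)) = (0, Some (false, true)) by apply IH; split.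
by move=> -> -> ->.
Qed.

Section Orientation.
Variables (u v : seq (nat * bool)) (P : pred nat).
Hypothesis huv : kieq u v.
Local Notation keep := (filter (fun l : nat * bool => P l.1)).
Hypothesis oriented : forall x b, (x, b) \in keep u -> (x, ~~ b) \notin keep u.

(** If [x] has only one exponent in [u], send that letter to e_01 and all other variables to the
    identity; [kprod_oriented] then detects the opposite exponent in [v]. *)
Lemma keep_sub l : l \in keep v -> l \in keep u.
Proof.
case: l => x b hl; apply: contraT => hn; have Px : P x by move: hl; rewrite mem_filter => /andP[].
have hx : (x, ~~ b) \in keep u.
  have : x \in map fst u.
    by rewrite (kieq_vars _ huv); apply/mapP; exists (x, b) => //; move: hl; rewrite mem_filter => /andP[].
  case/mapP=> -[y c] hy /= e; subst y.
  have hc : (x, c) \in keep u by rewrite mem_filter /= Px.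
  have : c != b by apply: contraNneq hn => <-.
  by case: c b hc {hl hn hy} => [] [].
pose g y : kel := if y == x then (0, Some (~~ b == true, b)) else kone.
have hg w : kprod (klit g) w =
    kprod (fun c => (0, Some (c, ~~ c))) [seq l.2 == b | l <- w & l.1 == x].
  elim: w => [|[y c] w IH] //; rewrite [LHS]/= IH /= /klit /g /=.
  case: (y == x) => /=; last by case: c; rewrite kmul1.
  by case: c b {hl hn hx g IH} => [] [].
have := huv g; rewrite !hg => h.
have hno : (x, b) \notin u by move: hn; rewrite mem_filter /= Px.
have hin : (x, ~~ b) \in u by move: hx; rewrite mem_filter /= Px.
have hv : (x, b) \in v by move: hl; rewrite mem_filter => /andP[].
pose bits w := [seq l.2 == b | l : nat * bool <- w & l.1 == x].
have [_ /negP[]] : bits v <> [::] /\ true \notin bits v.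
  apply/kprod_oriented; rewrite -h; apply/kprod_oriented; split.
    move/(congr1 size); rewrite size_map size_filter => /eqP.
    rewrite -leqn0 leqNgt -has_count => /hasP[]; by exists (x, ~~ b) => /=.
  apply/mapP=> -[[y c]]; rewrite mem_filter /= => /andP[/eqP-> hc] /esym/eqP e.
  by rewrite e in hc; rewrite hc in hno.
by apply/mapP; exists (x, b); rewrite ?mem_filter /= eqxx.
Qed.

(** As each kept variable has a single exponent, arbitrary values of the kept letters come from
    values of the variables. *)
Lemma kieq_keep : keq (keep u) (keep v).
Proof.
move=> g; pose f x : kel :=
  if (x, false) \in keep u then g (x, false)
  else if (x, true) \in keep u then kstar (g (x, true)) else kone.
have hf (w : seq (nat * bool)) : (forall l, l \in keep w -> l \in keep u) ->
    (forall l, l \in w -> ~~ P l.1 -> klit f l = kone) -> kprod (klit f) w = kprod g (keep w).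
  elim: w => //= l w IH h h'; case: (boolP (P l.1)) => Pl /=; last first.
    rewrite h' ?mem_head // kmul1; apply: IH => [m hm|m hm]; last by apply: h'; rewrite inE hm orbT.
    by apply: h; rewrite (negbTE Pl).
  rewrite Pl in h; rewrite IH => [|m hm|m hm]; last first.
  - by apply: h'; rewrite inE hm orbT.
  - by apply: h; rewrite inE hm orbT.
  congr kmul; have := h _ (mem_head _ _); case: l Pl {h h'} => x [] Px hl; rewrite /klit /f /=.
    by have := oriented hl => /= /negbTE->; rewrite hl kstarK.
  by rewrite hl.
have h0 (w : seq (nat * bool)) l : l \in w -> ~~ P l.1 -> klit f l = kone.
  move=> _ nP; rewrite /klit /f !mem_filter /= (negbTE nP) /=; by case: l.2.
rewrite -(hf u (fun _ => id) (h0 u)) -(hf v (fun l => @keep_sub l) (h0 v)).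
exact: huv.
Qed.
End Orientation.

(** * The semigroup of factors *)

Definition mark (b : bool) (s : seq alpha) : seq (alpha * bool) := [seq (a, b) | a <- s].

Definition estar (s : seq (alpha * bool)) := rev [seq (l.1, ~~ l.2) | l <- s].

Lemma estarK : involutive estar.
Proof.
move=> s; rewrite /estar map_rev revK -map_comp -[RHS]map_id.
by apply: eq_map => -[a b] /=; rewrite negbK.
Qed.

Lemma estar_cat s t : estar (s ++ t) = estar t ++ estar s.
Proof. by rewrite /estar map_cat rev_cat. Qed.

Lemma estar_infix s t : infix (estar s) (estar t) = infix s t.
Proof.
have h x y : infix x y -> infix (estar x) (estar y).
  by move=> /infixP[a [b ->]]; rewrite !estar_cat -catA; apply/infixP; do 2!eexists.
by apply/idP/idP=> /h //; rewrite !estarK.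
Qed.

Lemma infix_sub (T : eqType) (a x b t : seq T) : infix (a ++ x ++ b) t -> infix x t.
Proof.
by move=> /infixP[p [q ->]]; apply/infixP; exists (p ++ a), (b ++ q); rewrite -!catA.
Qed.

Section FactorSemigroup.
Variable W : seq alpha.

Definition occurs s := infix s (mark false W) || infix s (estar (mark false W)).

Lemma occurs_sub a x b : occurs (a ++ x ++ b) -> occurs x.
Proof. by case/orP=> /infix_sub h; apply/orP; [left|right]. Qed.

Lemma occurs_estar s : occurs (estar s) = occurs s.
Proof. by rewrite /occurs estar_infix -{1}(estarK (mark false W)) estar_infix orbC. Qed.

Definition selt := option (seq (alpha * bool)).

(** Elements are arbitrary words; only products are tested for occurrence, so evaluating a
    one-letter term tests nothing. *)
Definition smul (x y : selt) : selt :=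
  if x is Some a then if y is Some b then if occurs (a ++ b) then Some (a ++ b) else None
  else None else None.

Definition sstar (x : selt) : selt := omap estar x.

Lemma smul_isg : is_isg smul sstar.
Proof.
split; [|split].
- move=> [a|] [b|] [c|] //=; last by case: occurs.
  have h1 : occurs (a ++ b ++ c) -> occurs (a ++ b).
    by rewrite catA => h; apply: (@occurs_sub [::] _ c).
  have h2 : occurs (a ++ b ++ c) -> occurs (b ++ c).
    by move=> h; apply: (@occurs_sub a _ [::]); rewrite cats0.
  case: (boolP (occurs (a ++ b ++ c))) => h; first by rewrite (h1 h) (h2 h) /= -catA h.
  by case: (occurs (b ++ c)); case: (occurs (a ++ b)); rewrite //= -?catA (negbTE h).
- move=> [a|] [b|] //=; rewrite -estar_cat occurs_estar; by case: ifP.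
by case=> [a|] //=; rewrite estarK.
Qed.

Variable f : nat -> selt.

Definition slit (l : nat * bool) : selt := if l.2 then sstar (f l.1) else f l.1.

Definition sword (l : nat * bool) : seq (alpha * bool) := odflt [::] (slit l).

Lemma iev_smul l s : s <> [::] -> iev smul sstar f (l, s) =
  if all (isSome \o slit) (l :: s) && occurs (flatten (map sword (l :: s)))
  then Some (flatten (map sword (l :: s))) else None.
Proof.
rewrite /iev /= -/(slit l); elim/last_ind: s => // s b IH _.
rewrite foldl_rcons -/(slit b) all_rcons map_rcons -cats1 flatten_cat /= cats0 /sword.
case: s IH => [|c s] IH.
  by rewrite /=; case: (slit l) => [x|]; case: (slit b) => [y|] //=; rewrite !cats0.
rewrite IH // /sword [all _ _]/= {IH}; set t := flatten _; set al := slit c && _.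
case: (slit l) => [x|]; case: (slit b) => [y|] //=; last by case: ifP.
case: al => //=; rewrite catA; case: (boolP (occurs (x ++ t))) => //= h; case: ifP => // h'.
by case/negP: h; apply: (@occurs_sub [::] _ y).
Qed.

Lemma sword_star x b : sword (x, ~~ b) = estar (sword (x, b)).
Proof. by rewrite /sword /slit /sstar; case: b; case: (f x) => [a|] //=; rewrite estarK. Qed.

End FactorSemigroup.

(** A factor of the unreversed word has no reversed marks, whereas [estar] flips marks. So a
    variable with nonempty image has a single exponent in [u], which reduces the claim to words
    without involution. *)
Lemma substitution_marked (r : nat) (W : seq alpha) (phi : nat * bool -> seq (alpha * bool)) u v :
  (forall x, infix x W -> factor r x) -> size u + 2 <= r -> kieq u v ->
  (forall x b, phi (x, ~~ b) = estar (phi (x, b))) ->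
  infix (flatten (map phi u)) (mark false W) ->
  flatten (map phi v) = flatten (map phi u).
Proof.
move=> hW hr huv hphi hin.
pose P x := phi (x, false) != [::].
have hP l : P l.1 = (phi l != [::]).
  case: l => x [] //=; rewrite (hphi x false) /P /estar -!size_eq0 size_rev size_map //.
pose keep := filter (fun l : nat * bool => P l.1).
have hkeep w : flatten (map phi w) = flatten (map phi (keep w)).
  elim: w => //= l w ->; case: ifP => //=; rewrite hP.
  by case: (phi l).
have hmark l : l \in u -> phi l = mark false (map fst (phi l)).
  move=> hl; rewrite /mark -map_comp -[LHS]map_id; apply/eq_in_map => -[a c] ha /=.
  have : (a, c) \in mark false W.
    have /infixP[p [q ->]] := hin; rewrite !mem_cat; apply/orP; right; apply/orP; left.
    by apply/flattenP; exists (phi l) => //; apply: map_f.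
  by case/mapP=> a' _ [_ ->].
have oriented x b : (x, b) \in keep u -> (x, ~~ b) \notin keep u.
  move=> h1; apply/negP=> h2; move: h1 h2; rewrite !mem_filter !hP => /andP[h1 /hmark e1].
  case/andP=> _ /hmark; rewrite hphi; move: h1; rewrite e1.
  case: (map fst _) => //= a s _ e.
  have : (a, true) \in estar (mark false (a :: s)) by rewrite mem_rev mem_head.
  by rewrite e => /mapP[].
have hk : keq (keep u) (keep v) := kieq_keep huv oriented.
pose psi l := map fst (phi l).
have hpsi w : {subset w <= u} -> flatten (map phi w) = mark false (subst_word psi w).
  rewrite /mark map_flatten -map_comp => hw; congr flatten; apply/eq_in_map => l /hw.
  exact: hmark.
have hu l : l \in keep u -> l \in u by rewrite mem_filter => /andP[].
have hv l : l \in keep v -> l \in u by rewrite -(perm_mem (keq_perm hk)) => /hu.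
rewrite hkeep [RHS]hkeep !hpsi //; congr mark.
apply: (@substitution_determined r _ (keep u)) => //.
  by rewrite size_filter; apply: leq_trans hr; rewrite leq_add2r count_size.
apply: hW; move: hin; rewrite hkeep hpsi // => /infixP[p [q e]].
apply/infixP; exists (map fst p), (map fst q).
by have := congr1 (map fst) e; rewrite !map_cat /mark -!map_comp !map_id.
Qed.

Lemma factor_semigroup_isat (r : nat) (W : seq alpha) (s : iword * iword) :
  (forall x, infix x W -> factor r x) -> size s.1.2 + 3 <= r ->
  isat kmul kstar (fun _ => True) s -> isat (smul W) sstar (fun _ => True) s.
Proof.
move=> hW hr /isat_kieq huv f _.
case: s hr huv => [[l1 s1] [l2 s2]] /= hr huv.
have hsz : size s1 = size s2.
  have h w : kprod (klit (fun _ => (1, None))) w = (size w, None).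
    by elim: w => //= l w ->; rewrite /klit /=; case: l.2.
  by have := huv (fun _ => (1, None)); rewrite !h => -[].
case: s1 hsz hr huv => [|a s1].
  case: s2 => // _ _ huv.
  have e : keq [:: l1] [:: l2].
    have := @kieq_keep [:: l1] [:: l2] predT huv; apply=> x b.
    by rewrite !inE => /eqP<-; apply/eqP=> -[]; case: b.
  have /perm_mem/(_ l2) := keq_perm e.
  by rewrite !inE eqxx => /eqP->.
case: s2 => // b s2 hsz hr huv.
set u := l1 :: a :: s1 in huv; set v := l2 :: b :: s2 in huv.
have hszuv : size u = size v by rewrite /u /v /=; case: hsz => ->.
have hru : size u + 2 <= r by move: hr; rewrite /u /=; lia.
have main w w' : kieq w w' -> size w + 2 <= r ->
    occurs W (flatten (map (sword f) w)) ->
    flatten (map (sword f) w') = flatten (map (sword f) w).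
  move=> hww hw /orP[h|h].
    by apply: (substitution_marked hW hw hww _ h) => x c; apply: sword_star.
  (* A factor of the reversed copy is handled by reversing both words. *)
  pose phi l := estar (sword f l).
  have hrev t : estar (flatten (map (sword f) t)) = flatten (map phi (rev t)).
    elim: t => //= l t IH; rewrite estar_cat IH rev_cons -cats1 map_cat flatten_cat /=.
    by rewrite cats0.
  apply: (can_inj estarK); rewrite !hrev.
  apply: (@substitution_marked r W phi (rev w)) => //; rewrite ?size_rev //; first exact: kieq_rev.
    by move=> x c; rewrite /phi sword_star.
  by rewrite -hrev -[mark _ _]estarK estar_infix.
have hall w w' : kieq w w' -> all (isSome \o slit f) w -> all (isSome \o slit f) w'.
  move=> hww /allP h; apply/allP=> -[x c] hx.
  have : x \in map fst w by rewrite (kieq_vars _ hww); apply/mapP; exists (x, c).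
  case/mapP=> -[y d] /h + /= e; rewrite -e /slit /sstar /=.
  by case: c {hx}; case: d; case: (f x).
rewrite !iev_smul // -/u -/v.
have hvu : kieq v u by move=> g.
case: ifP => [/andP[h1 h2]|hu].
  by rewrite (hall _ _ huv h1) (main _ _ huv hru h2) h2.
case: ifP => // /andP[h1 h2]; move: hu.
by rewrite (hall _ _ hvu h1) (main _ _ hvu _ h2) ?h2 // -hszuv.
Qed.

(** * Separating identities *)

Lemma digit_lt r f k : 0 < r -> digit r f k < r.
Proof. by move=> hr; elim: f k => //= f IH k; case: ifP => // _; rewrite ltn_mod. Qed.

Lemma factor_infix r a x b : factor r (a ++ x ++ b) -> factor r x.
Proof.
case=> k hk; exists (k + size a).
have -> : x = take (size x) (drop (size a) (a ++ x ++ b)).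
  by rewrite drop_size_cat // take_size_cat.
rewrite {1}hk -map_drop -map_take drop_iota take_iota size_take size_drop !size_cat.
by congr (map _ (iota _ _)); rewrite addnC //; lia.
Qed.

(** The shorter word is a prefix of the longer one, so its square starts the product. *)
Lemma commuting_square (T : eqType) (p q : seq T) : p != [::] -> q != [::] ->
  p ++ q = q ++ p -> exists2 z, z != [::] & exists t, p ++ q = z ++ z ++ t.
Proof.
have main (x y : seq T) : size x <= size y -> x ++ y = y ++ x -> exists t, x ++ y = x ++ x ++ t.
  move=> hs e; exists (drop (size x) y); congr (_ ++ _).
  rewrite -{1}(cat_take_drop (size x) y); congr (_ ++ _).
  by have := congr1 (take (size x)) e; rewrite take_size_cat // takel_cat.
move=> hp hq e; case: (leqP (size p) (size q)) => h.
  by exists p => //; apply: main.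
by exists q => //; rewrite e; apply: main; rewrite ?(ltnW h).
Qed.

Definition lift_word (w : word) : iword := ((w.1, false), [seq (x, false) | x <- w.2]).

Definition lift_identity (s : word * word) : iword * iword := (lift_word s.1, lift_word s.2).

Lemma isat_lift (S : Type) mul star (P : S -> Prop) s :
  isat mul star P (lift_identity s) <-> sat mul P s.
Proof.
have h f w : iev mul star f (lift_word w) = ev mul f w.
  by case: w => x w; rewrite /iev /ev /=; elim: w (f x) => //= y w IH a.
by split=> H f hf; have := H f hf; rewrite !h.
Qed.

Definition code (r : nat) (a : alpha) : nat := a.1 * r + a.2.
Definition decode (r c : nat) : alpha := (c %/ r, c %% r).

(** The separating identity contains no star, so one semigroup serves both signatures. *)
Lemma separation (n m : nat) : exists W : seq alpha,
  (forall s, size s.1.2 <= m -> isat kmul kstar (fun _ => True) s ->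
     isat (smul W) sstar (fun _ => True) s) /\
  exists s : word * word, sat (@wmul n) (@wvalid n) s /\ ~ sat (smul W) (fun _ => True) s.
Proof.
pose r := m + 3; have r_gt1 : 1 < r by rewrite /r; lia.
have r_gt2 : 2 < r by rewrite /r; lia.
have r_gt0 : 0 < r by lia.
have [M hM] := wire_identity n (r * r).
pose w k := code r (letter r k).
have letterK k : decode r (w k) = letter r k.
  have : (letter r k).2 < r by apply: digit_lt.
  rewrite /decode /w /code; case: (letter r k) => a b /= hb.
  by rewrite divnMDl // modnMDl (divn_small hb) (modn_small hb) addn0.
have [|i [j [l [hi hij hjl hlM hsat]]]] := hM w.
  move=> k; have : (letter r k).2 < r by apply: digit_lt.
  have : (letter r k).1 < r by apply: ltn_pmod.
  by rewrite /w /code; case: (letter r k) => a b /=; nia.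
pose W := [seq letter r k | k <- iota 0 M].
have hW x : infix x W -> factor r x.
  move=> /infixP[a [b e]]; apply: (@factor_infix r a x b); exists 0.
  by rewrite -e /W size_map size_iota.
exists W; split.
  by move=> s hs; apply: (factor_semigroup_isat hW); rewrite leq_add2r.
exists ((w 0, segment w 1 i ++ segment w i j ++ segment w j l),
        (w 0, segment w 1 i ++ segment w j l ++ segment w i j)).
split=> // /(proj2 (isat_lift _ sstar _ _)) H.
(* Each variable goes to the single letter it encodes, so the left side evaluates to a prefix of
   [W]. *)
pose f c : selt := Some [:: (decode r c, false)].
have {H} := H f (fun _ => I).
have hev t : t <> [::] -> iev (smul W) sstar f (lift_word (w 0, map w t)) =
    let x := mark false (map (letter r) (0 :: t)) in if occurs W x then Some x else None.
  move=> ht; have hfl (s : seq nat) : flatten (map (sword f) [seq (x, false) | x <- map w s]) =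
      mark false (map (letter r) s).
    by elim: s => //= k s ->; rewrite /sword /slit /= letterK.
  rewrite iev_smul; last by case: t ht.
  have -> : all (isSome \o slit f) ((w 0, false) :: [seq (x, false) | x <- map w t]).
    by apply/allP=> _ /(mapP (s := w 0 :: map w t))[x _ ->].
  by have /= -> := hfl (0 :: t).
rewrite /segment -!map_cat /lift_identity [(_, _).1]/= [(_, _).2]/= !hev;
  try by move/(congr1 size); rewrite /= !size_cat !size_iota; lia.
set p := iota i (j - i); set q := iota j (l - j).
have epq : 0 :: iota 1 (i - 1) ++ p ++ q = iota 0 l.
  rewrite (_ : l = 1 + ((i - 1) + ((j - i) + (l - j)))); last by lia.
  by rewrite !iotaD /p /q /=; congr (_ :: _ ++ _ ++ _); congr iota; lia.
have hocc : occurs W (mark false (map (letter r) (iota 0 l))).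
  apply/orP; left; apply/infixP; exists [::], (mark false (map (letter r) (iota l (M - l)))).
  by rewrite -map_cat -map_cat -iotaD subnKC.
cbv zeta; rewrite epq hocc; case: ifP => // _ /Some_inj.
have mark_inj : injective (mark false) by apply: inj_map => a b [].
move=> /mark_inj; rewrite -epq /= !map_cat => -[/eqP]; rewrite eqseq_cat // eqxx /= => /eqP e.
have [||z hz [t ht]] := commuting_square _ _ e.
- by rewrite -size_eq0 size_map size_iota; lia.
- by rewrite -size_eq0 size_map size_iota; lia.
have : factor r (z ++ z).
  apply: (@factor_infix r [::] _ t); rewrite /= -catA -ht.
  exists i; rewrite -map_cat size_map size_cat !size_iota; congr map.
  by rewrite iotaD; congr (_ ++ iota _ _); lia.
by move/(square_free r_gt1 r_gt2)=> z0; rewrite z0 in hz.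
Qed.


(* A variety V is given as Mod(Sigma) for a set Sigma of identities.
   var K_3 ⊆ V  <->  K_3 satisfies Sigma;
   V ⊆ var W_n  <->  every semigroup in V satisfies every identity of W_n. *)
Theorem theorem2 (n : nat) (hn : 3 <= n) :
  (* plain semigroups *)
  (forall Sig : word * word -> Prop,
     (forall s, Sig s -> sat (@wmul 3) (@inK 3) s) ->
     (forall (S : Type) (mul : S -> S -> S), is_sg mul -> sat_all mul Sig ->
        forall s, sat (@wmul n) (@wvalid n) s -> sat mul (fun _ => True) s) ->
     ~ sg_finitely_based Sig) /\
  (* involution semigroups *)
  (forall Sig : iword * iword -> Prop,
     (forall s, Sig s -> isat (@wmul 3) (@wstar 3) (@inK 3) s) ->
     (forall (S : Type) (mul : S -> S -> S) (star : S -> S), is_isg mul star ->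
        isat_all mul star Sig ->
        forall s, isat (@wmul n) (@wstar n) (@wvalid n) s -> isat mul star (fun _ => True) s) ->
     ~ isg_finitely_based Sig).
Proof.
have kisg : is_isg kmul kstar by split; [exact: kmulA|split; [exact: kstarM|exact: kstarK]].
split=> Sig hK hW [L hL].
  (* The identities in [L] hold in K_3, so by the choice of [m] the factor semigroup satisfies [L],
     hence [Sig], hence every identity of the wire monoid, contrary to [hns]. *)
  pose m := \max_(s <- L) size s.1.2.
  have [W [hS [s [hs hns]]]] := separation n m; have [Wsg _] := smul_isg W.
  apply/hns/(hW _ _ Wsg) => //; apply/(hL _ _ Wsg) => t ht.
  apply/(isat_lift _ sstar)/hS; first by rewrite size_map; apply: (leq_bigmax_seq _ ht).
  apply/isat_lift; apply: (proj1 (hL _ _ kmulA)) ht => t' /hK ht'.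
  by apply/(isat_lift _ kstar)/kel_isat/isat_lift.
pose m := \max_(s <- L) size s.1.2.
have [W [hS [s [hs hns]]]] := separation n m; have Wisg := smul_isg W.
apply: hns; apply/(isat_lift _ sstar)/(hW _ _ _ Wisg); last exact/isat_lift.
apply/(hL _ _ _ Wisg) => t ht; apply: hS; first by apply: (leq_bigmax_seq _ ht).
by apply: (proj1 (hL _ _ _ kisg)) ht => t' /hK/kel_isat.
Qed.
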